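(* For every integer $n\ge 1$, the lattice of noncrossing partitions $NC^A_n$ is a subposet of $P^A_n$, in the sense that $P^A_n$ is an extension of the refinement order: there exists a bijection $\varphi\colon NC^A_n\to P^A_n$ such that for all $\pi,\tau\in NC^A_n$, if $\pi<\tau$ in $NC^A_n$ then $\varphi(\pi)<\varphi(\tau)$ in $P^A_n$.
   Context: Let $[n]=\{1,2,\dots,n\}$. A set partition $\pi$ of $[n]$ is noncrossing if there are no four elements $1\le a<b<c<d\le n$ such that $a,c$ lie in one block of $\pi$ and $b,d$ lie in a different block of $\pi$. $NC^A_n$ is the set of noncrossing partitions of $[n]$ ordered by refinement: $\pi\le\nu$ if each block of $\nu$ is a union of blocks of $\pi$. A permutation $p=p_1p_2\cdots p_n$ of $[n]$ (one-line notation) is 132-avoiding if there are no positions $1\le a<b<c\le n$ with $p_a<p_c<p_b$. Its descent set is $\mathrm{Des}(p)=\{i\in[n-1] : p_i>p_{i+1}\}$. $P^A_n$ is the poset whose elements are the 132-avoiding permutations of $[n]$, with strict order $p<q$ if and only if $\mathrm{Des}(p)\subsetneq\mathrm{Des}(q)$ (so distinct permutations with the same descent set are incomparable). *)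

(* Defs.v *)
(* The set [n] = {1, ..., n} is encoded as 'I_n = {0, ..., n-1}: ground-set
   elements, and positions and values of permutations, are all shifted by one. *)
From HB Require Import structures.
From mathcomp Require Import all_boot all_order all_fingroup.

Set Implicit Arguments.
Unset Strict Implicit.
Unset Printing Implicit Defensive.

Definition noncrossing n (P : {set {set 'I_n}}) : bool :=
  [forall a : 'I_n, forall b : 'I_n, forall c : 'I_n, forall d : 'I_n,
     forall B in P, forall C in P,
     ~~ [&& a < b, b < c, c < d, a \in B, c \in B, b \in C, d \in C & B != C]].

Record ncpart n := NCPart {
  ncpart_val :> {set {set 'I_n}};
  _ : partition ncpart_val [set: 'I_n] && noncrossing ncpart_val
}.

HB.instance Definition _ n := [isSub for @ncpart_val n].
HB.instance Definition _ n := [Finite of ncpart n by <:].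

Definition refines n (P Q : {set {set 'I_n}}) : bool :=
  [forall B in Q, exists S : {set {set 'I_n}}, (S \subset P) && (B == cover S)].

Lemma ncpart_partition n (P : ncpart n) : partition P [set: 'I_n].
Proof. by case: P => P /= /andP[]. Qed.

Lemma refinesP n (P Q : {set {set 'I_n}}) :
  reflect (forall B, B \in Q -> forall x, x \in B ->
             exists2 A, A \in P & (x \in A) && (A \subset B))
          (refines P Q).
Proof.
apply: (iffP forall_inP) => [H B BQ x xB | H B BQ].
  have /existsP[S /andP[SP /eqP defB]] := H B BQ.
  move: xB; rewrite {1}defB => /bigcupP[A AS xA].
  exists A; first exact: (subsetP SP).
  by rewrite xA defB /= (bigcup_sup A).
apply/existsP; exists [set A in P | A \subset B]; apply/andP; split.
  by apply/subsetP=> A; rewrite inE => /andP[].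
apply/eqP/setP=> x; apply/idP/bigcupP=> [xB | [A]].
  have [A AP /andP[xA sAB]] := H B BQ x xB.
  by exists A; rewrite // inE AP.
by rewrite inE => /andP[_ /subsetP]; apply.
Qed.

Definition nc_le n (P Q : ncpart n) : bool := refines P Q.

Fact nc_le_refl n : reflexive (@nc_le n).
Proof. by move=> P; apply/refinesP=> B BP x xB; exists B; rewrite ?xB /=. Qed.

Lemma refines_sub n (P Q : ncpart n) : nc_le P Q -> nc_le Q P ->
  {subset Q <= P}.
Proof.
move=> /refinesP PQ /refinesP QP B BQ.
have /and3P[_ /trivIsetP tQ n0] := ncpart_partition Q.
have /set0Pn[x xB] : B != set0 by apply: contraNneq n0 => <-.
have [A AP /andP[xA sAB]] := PQ B BQ x xB.
have [C CQ /andP[xC sCA]] := QP A AP x xA.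
have eBC : B = C.
  apply/eqP; apply/negPn/negP=> /(tQ _ _ BQ CQ) /pred0Pn[].
  by exists x; rewrite /= xB xC.
by have -> : B = A by apply/eqP; rewrite eqEsubset sAB eBC sCA.
Qed.

Fact nc_le_anti n : antisymmetric (@nc_le n).
Proof.
move=> P Q /andP[PQ QP]; apply/val_inj/setP=> B.
by apply/idP/idP; apply: refines_sub.
Qed.

Fact nc_le_trans n : transitive (@nc_le n).
Proof.
move=> Q P R /refinesP PQ /refinesP QR; apply/refinesP=> B BR x xB.
have [C CQ /andP[xC sCB]] := QR B BR x xB.
have [A AP /andP[xA sAC]] := PQ C CQ x xC.
by exists A; rewrite // xA (subset_trans sAC).
Qed.

Fact nc_display : Order.disp_t. Proof. exact: Order.Disp tt tt. Qed.

HB.instance Definition _ n :=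
  Order.Le_isPOrder.Build nc_display (ncpart n)
    (@nc_le_refl n) (@nc_le_anti n) (@nc_le_trans n).

Definition avoids132 n (p : 'S_n) : bool :=
  [forall a : 'I_n, forall b : 'I_n, forall c : 'I_n,
     ~~ [&& a < b, b < c, p a < p c & p c < p b]].

(* The last position has no successor j, so Des p only contains i with i+1 < n. *)
Definition Des n (p : 'S_n) : {set 'I_n} :=
  [set i : 'I_n | [exists j : 'I_n, (val j == i.+1) && (p j < p i)]].

Record av132 n := Av132 { av132_val :> 'S_n; _ : avoids132 av132_val }.

HB.instance Definition _ n := [isSub for @av132_val n].
HB.instance Definition _ n := [Finite of av132 n by <:].

(* Distinct permutations with equal descent sets are incomparable: the strict
   order is primitive and p <= q is (p == q) || des_lt p q. *)
Definition des_lt n (p q : av132 n) : bool := Des p \proper Des q.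

Fact des_lt_irr n : irreflexive (@des_lt n).
Proof. by move=> p; rewrite /des_lt properxx. Qed.

Fact des_lt_trans n : transitive (@des_lt n).
Proof. by move=> q p r; apply: proper_trans. Qed.

Fact des_display : Order.disp_t. Proof. exact: Order.Disp tt tt. Qed.

HB.instance Definition _ n :=
  Order.Lt_isPOrder.Build des_display (av132 n)
    (@des_lt_irr n) (@des_lt_trans n).

(* Main.v *)
(* Both a noncrossing partition and a 132-avoiding permutation p of [n] are
   encoded by a map f with i <= f i, and f j <= f i whenever i <= j <= f i:
   for a partition, f i is the maximum of the block of i; for p, f i is the
   last position of the longest run starting at i on which no value exceeds
   p i.  If p avoids 132, then for i < j one has p i > p j iff some k in
   [i, j) has f k >= j, so f determines p; conversely this rule turns every f
   into a 132-avoiding permutation.  Under the resulting bijection the descents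
   are the elements which are not maximal in their block.  Merging blocks can
   only enlarge that set, and strictly so, as two merged blocks cannot both keep
   their maximum. *)
Require Import Defs.
From mathcomp Require Import all_boot all_order all_fingroup.
From mathcomp Require Import zify.

Set Implicit Arguments.
Unset Strict Implicit.
Unset Printing Implicit Defensive.

(** * Permutations built from nested maps *)

Definition nested n (f : 'I_n -> 'I_n) : Prop :=
  (forall i : 'I_n, i <= f i) /\
  (forall i j : 'I_n, i <= j -> j <= f i -> f j <= f i).

Definition inversion n (f : 'I_n -> 'I_n) (i j : 'I_n) : bool :=
  [exists k : 'I_n, [&& i <= k, k < j & j <= f k]].

(** The order that the values at [i] and [j] are to have in the permutation under construction. *)
Definition below n (f : 'I_n -> 'I_n) (i j : 'I_n) : bool :=
  (i < j) && ~~ inversion f i j || inversion f j i.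

Section PermOfFunction.
Variables (n : nat) (f : 'I_n -> 'I_n).
Implicit Types i j k : 'I_n.

Lemma inversionP i j :
  reflect (exists k : 'I_n, [/\ i <= k, k < j & j <= f k]) (inversion f i j).
Proof. by apply: (iffP existsP) => -[k /and3P]; exists k. Qed.

Lemma inversion_lt i j : inversion f i j -> i < j.
Proof. by case/inversionP=> k [ik kj _]; apply: leq_ltn_trans kj. Qed.

Lemma inversion_widen i j k : i <= j -> inversion f j k -> inversion f i k.
Proof.
move=> ij /inversionP[x [jx xk kx]]; apply/inversionP.
by exists x; split=> //; apply: leq_trans jx.
Qed.

(** The witness lies either before [j], where its image still reaches past [j], or in [[j, k)]. *)
Lemma inversion_split i j k :
  inversion f i k -> j < k -> inversion f i j \/ inversion f j k.
Proof.
move=> /inversionP[x [ix xk kx]] jk; case: (ltnP x j) => xj.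
  left; apply/inversionP; exists x; split=> //.
  by apply: ltnW; apply: leq_trans kx.
by right; apply/inversionP; exists x.
Qed.

Lemma below_irr i : below f i i = false.
Proof.
rewrite /below ltnn /=; case: (boolP (inversion f i i)) => // /inversion_lt.
by rewrite ltnn.
Qed.

Lemma below_lt i j : i < j -> below f i j = ~~ inversion f i j.
Proof.
move=> ij; rewrite /below ij /=; case: (boolP (inversion f j i)) => [|_].
  by move/inversion_lt; lia.
by rewrite orbF.
Qed.

Lemma below_gt i j : j < i -> below f i j = inversion f j i.
Proof. by move=> ji; rewrite /below ltnNge ltnW. Qed.

Lemma below_total i j : i != j -> below f i j || below f j i.
Proof.
rewrite neq_ltn => /orP[] ij; rewrite (below_lt ij) (below_gt ij).
  by rewrite orNb.
by rewrite orbN.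
Qed.

Lemma below_trans : transitive (below f).
Proof.
move=> j i k ij jk.
have nij : i != j by apply: contraTneq ij => ->; rewrite below_irr.
have njk : j != k by apply: contraTneq jk => ->; rewrite below_irr.
case: (eqVneq i k) => [eik | nik].
  subst k; move: nij ij jk; rewrite neq_ltn => /orP[] ij.
    by rewrite below_lt // below_gt // => /negPf->.
  by rewrite below_gt // below_lt // => ->.
(* Two of the eight sign patterns are contradictory; the other six reduce to widening or splitting
   an inversion. *)
move: nij njk nik ij jk; rewrite !neq_ltn.
case/orP=> ij; case/orP=> jk; case/orP=> ik; try by lia.
- rewrite !below_lt // => nij njk; apply/negP=> ik'.
  by case: (inversion_split ik' jk); apply/negP.
- rewrite (below_lt ij) (below_gt jk) => /negP nij kj; case: nij.
  exact: inversion_widen (ltnW ik) kj.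
- rewrite (below_lt ij) !below_gt // => /negP nij kj.
  by case: (inversion_split kj ij).
- rewrite (below_gt ij) !below_lt // => _; apply: contra.
  exact: inversion_widen (ltnW ij).
- rewrite (below_lt jk) !below_gt // => ji /negP njk.
  by case: (inversion_split ji ik).
- by rewrite !below_gt // => ji kj; apply: inversion_widen ji; apply: ltnW.
Qed.

Lemma rank_subproof i : #|[set j | below f j i]| < n.
Proof.
rewrite -[X in _ < X](card_ord n) -cardsT; apply: proper_card; apply/properP.
by split; [apply: subsetT | exists i; rewrite ?inE ?below_irr].
Qed.

Definition rank i : 'I_n := Ordinal (rank_subproof i).

Lemma rank_mono i j : below f i j -> rank i < rank j.
Proof.
move=> ij; apply: proper_card; apply/properP; split.
  by apply/subsetP=> k; rewrite !inE => /below_trans; apply.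
by exists i; rewrite ?inE ?below_irr.
Qed.

Lemma rank_ltE i j : (rank i < rank j) = below f i j.
Proof.
apply/idP/idP; last exact: rank_mono.
case: (eqVneq i j) => [->|/below_total/orP[] //]; first by rewrite ltnn.
by move/rank_mono; lia.
Qed.

Lemma rank_inj : injective rank.
Proof.
move=> i j eij; apply/eqP/negPn/negP => /below_total.
by rewrite -!rank_ltE eij ltnn.
Qed.

Definition perm_of : 'S_n := perm rank_inj.

Lemma perm_of_ltE i j : (perm_of i < perm_of j) = below f i j.
Proof. by rewrite !permE rank_ltE. Qed.

(** In a pattern 132 the last two positions form an inversion, which widens to one between the first
    and the last. *)
Lemma perm_of_avoids132 : avoids132 perm_of.
Proof.
apply/forallP=> a; apply/forallP=> b; apply/forallP=> c.
apply/negP=> /and4P[ab bc]; rewrite !perm_of_ltE.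
rewrite (below_lt (ltn_trans ab bc)) (below_gt bc) => /negP nac bc'.
by case: nac; apply: inversion_widen bc'; apply: ltnW.
Qed.

(** Between adjacent positions the only possible witness of an inversion is [i] itself. *)
Lemma mem_Des_perm_of i : nested f -> (i \in Des perm_of) = (i < f i).
Proof.
case=> le_f _; rewrite inE; apply/existsP/idP => [[j /andP[/eqP /= eij]]|ifi].
  have ij : i < j by rewrite [nat_of_ord j]eij.
  rewrite perm_of_ltE below_gt //.
  case/inversionP=> k [ik kj jk].
  have eik : i = k by apply: val_inj => /=; lia.
  by subst k; lia.
have jn : i.+1 < n by apply: leq_ltn_trans (ltn_ord (f i)).
exists (Ordinal jn); rewrite eqxx perm_of_ltE below_gt //=.
by apply/inversionP; exists i.
Qed.

End PermOfFunction.

Lemma eq_below n (f g : 'I_n -> 'I_n) : f =1 g -> below f =2 below g.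
Proof.
move=> efg i j.
have einv x y : inversion f x y = inversion g x y.
  by apply: eq_existsb => k; rewrite efg.
by rewrite /below !einv.
Qed.

Lemma card_ord_lt n (m : 'I_n) : #|[set k : 'I_n | k < m]| = m.
Proof.
rewrite -sum1dep_card -(big_ord_widen n (fun=> 1)) ?sum1_card ?card_ord //.
exact: ltnW.
Qed.

(** Each value [p i] is the number of positions carrying a smaller value. *)
Lemma perm_ltE_inj n (p q : 'S_n) :
  (forall i j, (p i < p j) = (q i < q j)) -> p = q.
Proof.
move=> epq; apply/permP=> i; apply: val_inj => /=.
rewrite -(card_ord_lt (p i)) -(card_ord_lt (q i)).
rewrite -(card_preimset _ (@perm_inj _ p)).
rewrite -(card_preimset [set k : 'I_n | k < q i] (@perm_inj _ q)).
by apply: eq_card => j; rewrite !inE epq.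
Qed.

(** * Recovering the nested map from a permutation *)

Section Reach.
Variable n : nat.
Implicit Types (p : 'S_n) (i j k : 'I_n).

Definition reach p i : 'I_n :=
  [arg max_(j > i | (i <= j) &&
     [forall k : 'I_n, (i < k) && (k <= j) ==> (p k < p i)]) (j : nat)].

Lemma reach_spec p i :
  extremum_spec geq (fun j => (i <= j) &&
     [forall k : 'I_n, (i < k) && (k <= j) ==> (p k < p i)])
     (fun j => j : nat) (reach p i).
Proof.
apply: arg_maxnP; rewrite leqnn /=.
by apply/forallP=> k; apply/implyP; lia.
Qed.

Lemma leq_reach p i : i <= reach p i.
Proof. by case: reach_spec => j /andP[]. Qed.

(** Runs starting at [i] are closed under shortening, so the maximal one decides all of them. *)
Lemma leq_reachP p i j :
  i <= j ->
  reflect (forall k, i < k -> k <= j -> p k < p i) (j <= reach p i).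
Proof.
case: reach_spec => r /andP[ir /forallP Hr] max_r ij.
apply: (iffP idP) => [jr k ik kj | H].
  by apply: (implyP (Hr k)); rewrite ik (leq_trans kj).
apply: max_r; rewrite ij; apply/forallP=> k; apply/implyP=> /andP[].
exact: H.
Qed.

Lemma reach_nested p : nested (reach p).
Proof.
split=> [|i j ij jr]; first exact: leq_reach.
have /leq_reachP Hj := leqnn (reach p j).
have Hi := elimT (leq_reachP p ij) jr.
apply/leq_reachP => [|k ik kr]; first exact: leq_trans (leq_reach p j).
(* Up to [j] the run of [i] bounds the values; beyond [j] they are below [p j], hence below
   [p i]. *)
case: (leqP k j) => [/Hi->//|jk].
apply: (@leq_trans (p j)); first by apply: Hj => //; apply: leq_reach.
case: (eqVneq i j) => [->//|nij]; apply/ltnW/Hi => //.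
by rewrite ltn_neqAle nij.
Qed.

Lemma reach_perm_of (f : 'I_n -> 'I_n) : nested f -> reach (perm_of f) =1 f.
Proof.
move=> [le_f nest_f] i; apply: val_inj; apply/eqP; rewrite eqn_leq /=.
apply/andP; split; last first.
  apply/leq_reachP => // k ik kf; rewrite perm_of_ltE below_gt //.
  by apply/inversionP; exists i.
rewrite leqNgt; apply/negP=> lt_fr.
(* A longer run would make [i] and [f i + 1] an inversion; its witness lies in [[i, f i]], where
   nestedness bounds [f] by [f i]. *)
have kn : (f i).+1 < n by apply: leq_ltn_trans (ltn_ord (reach (perm_of f) i)).
have ik : i < Ordinal kn by apply: le_f.
have /(leq_reachP _ (ltnW ik)) /(_ _ ik (leqnn _)) := lt_fr.
rewrite perm_of_ltE below_gt // => /inversionP[x [ix /= xk kx]].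
by have := nest_f i x ix; lia.
Qed.

Lemma inversion_reach p i j :
  avoids132 p -> i < j -> inversion (reach p) i j = (p j < p i).
Proof.
move=> av ij; apply/inversionP/idP => [[k [ik kj jr]] | pji].
  have pjk := elimT (leq_reachP p (ltnW kj)) jr j kj (leqnn _).
  (* If [p i < p j], the positions [i], [k], [j] would form a pattern 132. *)
  move/forallP: av => /(_ i) /forallP /(_ k) /forallP /(_ j).
  rewrite kj pjk /= andbT.
  case: (eqVneq i k) => [->//|nik]; rewrite ltn_neqAle nik ik /= -leqNgt.
  have nji : p j != p i by rewrite (inj_eq perm_inj) neq_ltn ij orbT.
  by rewrite leq_eqVlt (inj_eq val_inj) (negPf nji).
(* The witness is the position of the largest value on [[i, j)]: it dominates everything up to
   [j]. *)
have Pi : (i <= i) && (i < j) by rewrite leqnn.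
case: (@arg_maxnP _ i (fun k => (i <= k) && (k < j)) (fun k => p k) Pi) => k /andP[ik kj] max_k.
exists k; split=> //; apply/leq_reachP => [|x kx]; first exact: ltnW.
rewrite leq_eqVlt => /orP[/eqP /val_inj -> | xj].
  by apply: leq_trans pji _; apply: max_k.
have xk : p x <= p k by apply: max_k; rewrite xj (leq_trans ik) // ltnW.
by rewrite ltn_neqAle xk (inj_eq val_inj) (inj_eq perm_inj) neq_ltn kx orbT.
Qed.

Lemma below_reach p i j :
  avoids132 p -> below (reach p) i j = (p i < p j).
Proof.
move=> av; case: (ltngtP i j) => [ij|ji|/val_inj->].
- rewrite below_lt // inversion_reach // -leqNgt leq_eqVlt.
  by rewrite (inj_eq val_inj) (inj_eq perm_inj) [i == j]ltn_eqF.
- by rewrite below_gt // inversion_reach.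
- by rewrite below_irr ltnn.
Qed.

End Reach.

(** * Block maxima of noncrossing partitions *)

Section BlockMax.
Variable n : nat.
Implicit Types (P Q : ncpart n) (i j : 'I_n).

Lemma mem_cover_ncpart P i : i \in cover P.
Proof.
by have /and3P[/eqP-> _ _] := ncpart_partition P; rewrite inE.
Qed.

Lemma ncpart_trivIset P : trivIset P.
Proof. by have /and3P[] := ncpart_partition P. Qed.

Lemma eq_pblock_ncpart P i j :
  (pblock P i == pblock P j) = (j \in pblock P i).
Proof. exact: eq_pblock (ncpart_trivIset P) (mem_cover_ncpart P i). Qed.

Definition blockmax P i : 'I_n :=
  [arg max_(j > i in pblock P i) (j : nat)].

Lemma blockmax_spec P i :
  extremum_spec geq (fun j => j \in pblock P i) (fun j => j : nat)
    (blockmax P i).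
Proof. by apply: arg_maxnP; rewrite mem_pblock mem_cover_ncpart. Qed.

Lemma blockmax_mem P i : blockmax P i \in pblock P i.
Proof. by case: blockmax_spec. Qed.

Lemma leq_blockmax P i j : j \in pblock P i -> j <= blockmax P i.
Proof. by case: blockmax_spec => m _; apply. Qed.

Lemma pblock_blockmax P i : pblock P (blockmax P i) = pblock P i.
Proof. by apply/esym/eqP; rewrite eq_pblock_ncpart blockmax_mem. Qed.

(** A block contains its maximum, so blocks sharing a maximum coincide: the blocks are the fibres of
    [blockmax]. *)
Lemma blockmax_eqE P i j :
  (blockmax P i == blockmax P j) = (j \in pblock P i).
Proof.
rewrite -eq_pblock_ncpart; apply/eqP/eqP => [e | e].
  by rewrite -(pblock_blockmax P i) e pblock_blockmax.
apply/val_inj/eqP; rewrite eqn_leq /=.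
by apply/andP; split; apply: leq_blockmax; rewrite (e, =^~ e) blockmax_mem.
Qed.

(** Otherwise [i], [j] and the maxima of their blocks, in this order, would be a crossing. *)
Lemma blockmax_nested P : nested (blockmax P).
Proof.
have self i : i \in pblock P i by rewrite mem_pblock mem_cover_ncpart.
split=> [i | i j ij jm]; first exact: leq_blockmax.
rewrite leqNgt; apply/negP=> lt_m.
have nB : pblock P i != pblock P j.
  rewrite eq_pblock_ncpart -blockmax_eqE; apply: contraTneq lt_m => ->.
  by rewrite ltnn.
have : noncrossing P by case: (P) => S /= /andP[].
move/forallP=> /(_ i) /forallP /(_ j) /forallP /(_ (blockmax P i)).
move=> /forallP /(_ (blockmax P j)).
move=> /forall_inP /(_ _ (pblock_mem (mem_cover_ncpart P i))).
move=> /forall_inP /(_ _ (pblock_mem (mem_cover_ncpart P j))).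
rewrite lt_m !self !blockmax_mem nB !andbT /= => /negP; apply.
have nij : i != j by apply: contraNneq nB => ->.
have njm : j != blockmax P i.
  by apply: contraNneq nB => ->; rewrite pblock_blockmax.
by rewrite !ltn_neqAle nij ij njm.
Qed.

Lemma blockmax_inj P Q : blockmax P =1 blockmax Q -> P = Q.
Proof.
move=> e; apply: val_inj => /=.
rewrite -(preim_partition_pblock (ncpart_partition P)).
rewrite -(preim_partition_pblock (ncpart_partition Q)).
apply: eq_imset => i; apply/setP=> j.
by rewrite !inE /= !eq_pblock_ncpart -!blockmax_eqE !e.
Qed.

(** * The partition into fibres of a nested map *)

Section PartitionOfNested.
Variables (f : 'I_n -> 'I_n) (nest_f : nested f).

Lemma mem_pblock_preim i j :
  (j \in pblock (preim_partition f [set: 'I_n]) i) = (f i == f j).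
Proof.
rewrite pblock_equivalence_partition ?inE //.
by move=> x y z _ _ _; split=> //= /eqP->.
Qed.

(** If [f a = f c] and [f b = f d], then [b] lies in [[a, f a]] and [c] in [[b, f b]]; nestedness
    gives both inequalities between [f a] and [f b]. *)
Lemma preim_noncrossing :
  partition (preim_partition f [set: 'I_n]) [set: 'I_n] &&
  noncrossing (preim_partition f [set: 'I_n]).
Proof.
have part := preim_partitionP f [set: 'I_n].
have /and3P[_ triv _] := part.
case: nest_f => le_f H.
rewrite part; apply/forallP=> a; apply/forallP=> b; apply/forallP=> c.
apply/forallP=> d; apply/forall_inP=> B BP; apply/forall_inP=> C CP.
apply/negP=> /and5P[ab bc cd aB /and4P[cB bC dC /negP]]; apply.
move: (cB) (dC); rewrite -(def_pblock triv BP aB) -(def_pblock triv CP bC).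
rewrite !mem_pblock_preim => /eqP fac /eqP fbd.
rewrite eq_pblock //; last by rewrite -mem_pblock mem_pblock_preim.
rewrite mem_pblock_preim -(inj_eq val_inj) eqn_leq.
have lec := le_f c; have led := le_f d.
have -> : f b <= f a by apply: H; [lia | rewrite fac; lia].
by rewrite andbT fac; apply: H; [lia | rewrite fbd; lia].
Qed.

Definition partition_of : ncpart n := NCPart preim_noncrossing.

Lemma blockmax_partition_of : blockmax partition_of =1 f.
Proof.
move=> i; apply/val_inj/eqP; rewrite eqn_leq /=.
have [le_f H] := nest_f.
have := blockmax_mem partition_of i.
rewrite mem_pblock_preim => /eqP efi; apply/andP; split.
  by rewrite efi.
(* Nestedness makes [f] idempotent, so [f i] lies in the fibre of [i]. *)
apply: leq_blockmax; rewrite mem_pblock_preim -(inj_eq val_inj) eqn_leq.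
by rewrite le_f H.
Qed.

End PartitionOfNested.

(** * The bijection and its monotonicity *)

Definition perm_of_ncpart P : av132 n :=
  Av132 (perm_of_avoids132 (blockmax P)).

Definition ncpart_of_perm (p : av132 n) : ncpart n :=
  partition_of (reach_nested p).

(** [reach] recovers [blockmax] from the permutation, and [blockmax] determines the partition. *)
Lemma perm_of_ncpart_inj : injective perm_of_ncpart.
Proof.
move=> P Q /(congr1 (@av132_val n)) /= e; apply: blockmax_inj => i.
rewrite -(reach_perm_of (blockmax_nested P)) e.
exact: reach_perm_of (blockmax_nested Q) i.
Qed.

Lemma ncpart_of_permK : cancel ncpart_of_perm perm_of_ncpart.
Proof.
move=> p; apply: val_inj => /=; apply: perm_ltE_inj => i j.
rewrite perm_of_ltE (eq_below (blockmax_partition_of _)) below_reach //.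
by case: p.
Qed.

Lemma perm_of_ncpart_bij : bijective perm_of_ncpart.
Proof.
exists ncpart_of_perm; last exact: ncpart_of_permK.
exact: inj_can_sym ncpart_of_permK perm_of_ncpart_inj.
Qed.

Lemma mem_Des_perm_of_ncpart P i :
  (i \in Des (perm_of_ncpart P)) = (i < blockmax P i).
Proof. exact: mem_Des_perm_of (blockmax_nested P). Qed.

Lemma pblock_refines P Q i : refines P Q -> pblock P i \subset pblock Q i.
Proof.
have self (R : ncpart n) : i \in pblock R i by rewrite mem_pblock mem_cover_ncpart.
move/refinesP => /(_ _ (pblock_mem (mem_cover_ncpart Q i)) _ (self Q)).
by case=> A AP /andP[iA]; rewrite (def_pblock (ncpart_trivIset P) AP iA).
Qed.

Lemma blockmax_refines P Q i : refines P Q -> blockmax P i <= blockmax Q i.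
Proof.
move=> /(pblock_refines i)/subsetP sPQ.
by apply/leq_blockmax/sPQ/blockmax_mem.
Qed.

(** This gives strictness. A block maximum of [P] is no descent for [P], hence none for [Q], so it
    is also the maximum of the block of [Q] containing it. *)
Lemma Des_refines_eq P Q :
  refines P Q -> Des (perm_of_ncpart Q) \subset Des (perm_of_ncpart P) ->
  P = Q.
Proof.
move=> PQ /subsetP sD; apply: blockmax_inj => i.
have bmP := blockmax_nested P; have bmQ := blockmax_nested Q.
have fixP : blockmax P (blockmax P i) = blockmax P i.
  by apply/eqP; rewrite eq_sym blockmax_eqE blockmax_mem.
have fixQ : blockmax Q (blockmax P i) = blockmax P i.
  have := sD (blockmax P i); rewrite !mem_Des_perm_of_ncpart fixP ltnn.
  move=> H; apply/val_inj/eqP; rewrite eqn_leq bmQ.1 andbT leqNgt.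
  by apply/negP=> /H.
rewrite -fixQ; apply/eqP; rewrite eq_sym blockmax_eqE.
by apply: (subsetP (pblock_refines i PQ)); apply: blockmax_mem.
Qed.

End BlockMax.

Theorem theorem1 (n : nat) (n_ge1 : 1 <= n) :
  exists phi : ncpart n -> av132 n,
    bijective phi /\
    (forall P Q : ncpart n, (P < Q)%O -> (phi P < phi Q)%O).
Proof.
exists (@perm_of_ncpart n); split; first exact: perm_of_ncpart_bij.
move=> P Q; rewrite Order.POrderTheory.lt_neqAle => /andP[nPQ PQ].
(* The strict order on [av132] is proper inclusion of descent sets by definition. *)
change (Des (perm_of_ncpart P) \proper Des (perm_of_ncpart Q)).
rewrite properE; apply/andP; split.
  apply/subsetP=> i; rewrite !mem_Des_perm_of_ncpart => /leq_trans; apply.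
  exact: blockmax_refines.
by apply: contra nPQ => sD; apply/eqP/Des_refines_eq.
Qed.
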